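(* Let $G$ be a finite abelian group and let $p$ be a prime. Then $G$ satisfies property $\mathcal P(p)$ if and only if the (unique) $p$-Sylow subgroup of $G$ is not homocyclic.
   Context: For $\ell\ge1$ and $x\in G$, $r_\ell(x)=|\{g\in G:g^\ell=x\}|$. $G$ satisfies $\mathcal P(p)$ if there exist $a,b\in G$ of the same order with $0=r_p(a)<r_p(b)$ and $r_\ell(a)=r_\ell(b)$ for every square-free integer $1<\ell<p$. A homocyclic $p$-group is a direct product of cyclic $p$-groups all of the same order. *)

(* Defs.v *)
From mathcomp Require Import all_boot all_fingroup all_solvable.

Set Implicit Arguments.
Unset Strict Implicit.
Unset Printing Implicit Defensive.

Local Open Scope group_scope.

Definition nroots (gT : finGroupType) (G : {group gT}) (l : nat) (x : gT) : nat :=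
  #|[set g in G | g ^+ l == x]|.

Definition square_free (n : nat) : Prop :=
  forall d : nat, (d ^ 2 %| n)%N -> d = 1%N.

Definition property_P (gT : finGroupType) (G : {group gT}) (p : nat) : Prop :=
  exists a b : gT,
    [/\ a \in G /\ b \in G,
        #[a] = #[b],
        nroots G p a = 0%N,
        (0 < nroots G p b)%N
      & forall l : nat, (1 < l < p)%N -> square_free l ->
          nroots G l a = nroots G l b].

(* Main.v *)
(** In an abelian group [r_l(x)] is either [0] or the number of [l]-th roots of
    [1], so only the solvability of [g ^ l = x] matters; when [l] is coprime to
    the order of [x] it is always solvable, which makes the conditions for
    [l < p] free as soon as [a] and [b] are [p]-elements.
    If [P] is homocyclic of exponent [p ^ e > 1], a [p]-element is a [p]-th power iff
    its order is less than [p ^ e], a condition on the order alone. Conversely, if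
    being a [p]-th power in [P] depends only on the order, compare with the powers
    of an element of order [p ^ e]: every element of order [p ^ k] with [k < e] is
    a [p]-th power; iterating, every element of order [p] is a [p ^ (e - 1)]-th
    power, and this characterises homocyclic groups. *)
Require Import Defs.
From mathcomp Require Import all_boot all_fingroup all_solvable.

Local Open Scope group_scope.

Lemma nroots_gt0P (gT : finGroupType) (G : {group gT}) (l : nat) (x : gT) :
  reflect (exists2 g, g \in G & g ^+ l = x) (0 < nroots G l x)%N.
Proof.
apply: (iffP card_gt0P) => [[g] | [g Gg gl]].
  by rewrite inE => /andP[Gg /eqP gl]; exists g.
by exists g; rewrite inE Gg gl eqxx.
Qed.

(** Right translation by one root [h] of [x] carries the [l]-th roots of 1 onto those of [x]. *)
Lemma nroots_abelian (gT : finGroupType) (G : {group gT}) (l : nat) (x : gT) :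
  abelian G -> (0 < nroots G l x)%N -> nroots G l x = nroots G l 1.
Proof.
move=> abelG /nroots_gt0P[h Gh hl]; rewrite /nroots.
rewrite -[RHS](card_rcoset _ h); congr #|pred_of_set _|.
apply/setP=> g; rewrite mem_rcoset !inE groupMr ?groupV //.
have [Gg /= | //] := boolP (g \in G).
have cgh : commute g h^-1 by apply: (centsP abelG); rewrite ?groupV.
by rewrite expgMn // expgVn hl -eq_mulgV1.
Qed.

Lemma coprime_root (gT : finGroupType) (G : {group gT}) (l : nat) (x : gT) :
  x \in G -> coprime #[x] l -> exists2 g, g \in G & g ^+ l = x.
Proof.
move=> Gx co_xl; exists (x ^+ expg_invn <[x]> l); first exact: groupX.
by rewrite -expgM mulnC expgM expgK ?cycle_id.
Qed.

Lemma p_elt_root (gT : finGroupType) (p : nat) (g : gT) :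
  prime p -> p.-elt (g ^+ p) -> p.-elt g.
Proof.
move=> pr_p /p_natP[n ogp]; apply: (@pnat_dvd _ (p ^ n.+1)%N); last first.
  by rewrite pnatX pnat_id.
by rewrite order_dvdn expnS expgM -ogp expg_order.
Qed.

Lemma homocyclic_pth_power (gT : finGroupType) (P : {group gT}) (p : nat)
    (a h : gT) :
    prime p -> p.-group P -> homocyclic P -> a \in P -> h \in P ->
  #[a] = #[h ^+ p] -> exists2 g, g \in P & g ^+ p = a.
Proof.
move=> pr_p pP homP Pa Ph oa; have /andP[abelP _] := homP.
have /p_natP[e expP] : p.-nat (exponent P) by rewrite pnat_exponent.
case: e => [|e] in expP.
  have P1 : P :=: 1 by apply/eqP; rewrite trivg_exponent expP.
  by exists 1; rewrite // expg1n; move: Pa; rewrite P1 => /set1P.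
have := homocyclic_Ohm_Mho e pP homP.
rewrite expP pfactorK // subSnn => OhmMho.
have: a \in 'Ohm_e(P).
  rewrite (OhmEabelian pP (abelianS (Ohm_sub _ _) abelP)) !inE Pa /=.
  by rewrite -order_dvdn oa order_dvdn -expgM -expnS -expP expg_exponent.
by rewrite OhmMho (MhoEabelian 1 pP abelP) expn1 => /imsetP[g Pg ->]; exists g.
Qed.

Lemma homocyclic_of_pth_powers (gT : finGroupType) (P : {group gT}) (p : nat) :
    prime p -> p.-group P -> abelian P ->
    (forall a h, a \in P -> h \in P -> #[a] = #[h ^+ p] ->
       exists2 g, g \in P & g ^+ p = a) ->
  homocyclic P.
Proof.
move=> pr_p pP abelP rootP.
have [y Py expPy] := exponent_witness (abelian_nil abelP).
have /p_natP[e expP] : p.-nat (exponent P) by rewrite pnat_exponent.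
case: e => [|e] in expP.
  have P1 : P :=: 1 by apply/eqP; rewrite trivg_exponent expP.
  by rewrite P1 homocyclic1.
have oy : #[y] = (p ^ e.+1)%N by rewrite -expPy.
have deep_root d : (d <= e)%N -> forall x, x \in P -> #[x] = (p ^ (e - d).+1)%N ->
    exists2 w, w \in P & w ^+ (p ^ d) = x.
  elim: d => [|d IHd] led x Px ox; first by exists x.
  have [z Pz zp] : exists2 z, z \in P & z ^+ p = x.
    (* The order of [x] is that of [y ^+ (p ^ d.+1)], the [p]-th power of [y ^+ (p ^ d)]. *)
    apply: (rootP x (y ^+ (p ^ d))) => //; first exact: groupX.
    by rewrite -expgM -expnSr (orderXexp _ oy) ox subSS subnSK.
  have [|w Pw wz] := IHd (ltnW led) z Pz.
    (* As [p] divides the order of [x], the root [z] has order exactly [p] times larger, so [IHd]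
       applies to it. *)
    rewrite (orderXprime (congr1 (@order gT) zp)) // ox ?dvdn_exp //.
    by rewrite -expnS subnSK.
  by exists w; rewrite // expnSr expgM wz.
apply/(Ohm1_homocyclicP pP abelP); rewrite expP pfactorK //=.
rewrite (OhmEabelian pP (abelianS (Ohm_sub _ _) abelP)) expn1.
rewrite (MhoEabelian e pP abelP); apply/setP=> x; rewrite !inE.
apply/andP/imsetP=> [[Px xp] | [w Pw ->]]; last first.
  by rewrite groupX // -expgM -expnSr -expP expg_exponent.
have [-> | ntx] := eqVneq x 1; first by exists 1; rewrite ?expg1n.
have ox : #[x] = p by apply: nt_prime_order; rewrite ?(eqP xp).
have [|w Pw <-] := deep_root e (leqnn _) x Px; first by rewrite subnn expn1.
by exists w.
Qed.

Theorem theorem3p17 (gT : finGroupType) (G : {group gT}) (p : nat)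
    (abelG : abelian G) (pr_p : prime p) (P : {group gT})
    (sylP : p.-Sylow(G) P) :
  property_P G p <-> ~~ homocyclic P.
Proof.
have sPG := pHall_sub sylP; have pP := pHall_pgroup sylP.
have abelP := abelianS sPG abelG.
have memP x : (x \in P) = (x \in G) && p.-elt x.
  apply/idP/andP=> [Px | [Gx p_x]].
    by split; [apply: (subsetP sPG) | apply: mem_p_elt pP Px].
  have nP : P <| G by rewrite -sub_abelian_normal.
  by rewrite (mem_normal_Hall sylP).
split=> [[a [b [[Ga Gb] oab ra0 /nroots_gt0P[h Gh hp] _]]] | ].
  apply/negP=> homP.
  have memPc x : x \in G -> x.`_p \in P.
    by move=> Gx; rewrite memP p_elt_constt andbT groupX.
  (* Split [a] into its [p]-part and [p']-part. The [p]-part has the order of the [p]-part of [b],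
     which is a [p]-th power in [P]; the [p']-part has a root by coprimality. *)
  have [|g Pg gp] := homocyclic_pth_power _ _ _ _ _ pr_p pP homP (memPc a Ga) (memPc h Gh).
    by rewrite -consttX hp !order_constt oab.
  have [||g' Gg' gp'] := coprime_root _ G p a.`_p^'; first exact: groupX.
    by rewrite coprime_sym (pnat_coprime (pnat_id pr_p)) //; apply: p_elt_constt.
  have: (0 < nroots G p a)%N; last by rewrite ra0.
  have Gg := subsetP sPG g Pg; apply/nroots_gt0P; exists (g * g').
    exact: groupM.
  by rewrite expgMn ?gp ?gp' ?consttC //; apply: (centsP abelG).
move=> nhomP.
have /exists_inP[a Pa /exists_inP[h Ph /andP[/eqP oa noroot]]] :
    [exists a in P, exists h in P,
       (#[a] == #[h ^+ p]) && (nroots P p a == 0%N)].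
  apply: contraR nhomP => /exists_inPn nex.
  apply: homocyclic_of_pth_powers _ _ _ pr_p pP abelP _ => a h Pa Ph oa.
  apply/nroots_gt0P; rewrite lt0n; have /exists_inPn/(_ h Ph) := nex a Pa.
  by rewrite oa eqxx.
have Php : h ^+ p \in P by rewrite groupX.
exists a, (h ^+ p); split=> //.
- by split; apply: (subsetP sPG).
(* A [p]-th root in [G] of a [p]-element is again a [p]-element, so it would already lie in [P]. *)
- apply/eqP; rewrite -leqn0 leqNgt; apply: contraL noroot.
  move=> /nroots_gt0P[g Gg gp]; rewrite -lt0n; apply/nroots_gt0P; exists g => //.
  by rewrite memP Gg (p_elt_root _ _ _ pr_p) // gp (mem_p_elt pP).
- by apply/nroots_gt0P; exists h; rewrite ?(subsetP sPG).
move=> l /andP[l_gt1 ltlp] _.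
(* Since [0 < l < p], [l] is coprime to the order of every element of [P]; both counts then equal
   the number of [l]-th roots of 1. *)
have root x : x \in P -> (0 < nroots G l x)%N.
  move=> Px; apply/nroots_gt0P/coprime_root; first exact: (subsetP sPG).
  apply: pnat_coprime (mem_p_elt pP Px) _.
  by rewrite p'natE // gtnNdvd // ltnW.
by rewrite !(nroots_abelian _ _ _ _ abelG (root _ _)).
Qed.
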